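(* Let $(G,i)$ and $(H,i)$ be rooted graphs such that $(G,i)$ is a rooted minor of $(H,i)$. If $(G,i)$ allows the nullity pair $(k,\ell)$ with the SNIP, then $(H,i)$ allows the nullity pair $(k,\ell)$ with the SNIP.
   Context: All matrices are real. For a simple graph $G$ with vertex set $[n]$, $\mathcal{S}(G)$ is the set of real symmetric $n\times n$ matrices $A=[a_{jk}]$ such that for $j\neq k$, $a_{jk}\neq 0$ if and only if $\{j,k\}$ is an edge of $G$ (diagonal entries are unrestricted). For a symmetric matrix $A$ and index $i$, $A(i)$ is the principal submatrix obtained by deleting row and column $i$; the $i$-nullity pair of $A$ is $(\operatorname{null}(A),\operatorname{null}(A(i)))$, where a $0\times 0$ matrix has nullity $0$. A symmetric $n\times n$ matrix $A$ has the $i$-strong nullity interlacing property ($i$-SNIP) if $X=O$ is the only real symmetric matrix with $A\circ X=O$, $I\circ X=O$ and $(AX)(i,:]=O$, where $\circ$ is the entrywise product and $(AX)(i,:]$ denotes $AX$ with row $i$ deleted. A rooted graph is a pair $(G,i)$ with $G$ a simple graph and $i\in V(G)$. $(G,i)$ allows the nullity pair $(k,\ell)$ (with the SNIP) if some $A\in\mathcal{S}(G)$ has $i$-nullity pair $(k,\ell)$ (and has the $i$-SNIP). $(G,i)$ is a rooted minor of $(H,i)$ if $(G,i)$ can be obtained from $(H,i)$ by a sequence of edge deletions, deletions of isolated vertices other than the root, and edge contractions (contraction identifies the endpoints and removes loops and multiple edges; if the contracted edge is incident to the root, the new vertex is the root). *)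

(* Defs.v *)
From mathcomp Require Import all_boot all_order all_algebra.
From mathcomp Require Import reals.

Set Implicit Arguments.
Unset Strict Implicit.
Unset Printing Implicit Defensive.

Import GRing.Theory.

Record sgraph (n : nat) := SGraph {
  edge :> rel 'I_n;
  edge_sym : symmetric edge;
  edge_irr : irreflexive edge }.

Record rooted_graph := RootedGraph {
  rg_order : nat;
  rg_graph : sgraph rg_order;
  rg_root : 'I_rg_order }.

Section Operations.
Variables (n : nat) (H : sgraph n).

Definition delete_edge_rel (u v : 'I_n) : rel 'I_n :=
  fun x y => H x y && ([set x; y] != [set u; v]).

Lemma delete_edge_sym u v : symmetric (delete_edge_rel u v).
Proof. by move=> x y; rewrite /delete_edge_rel edge_sym setUC. Qed.

Lemma delete_edge_irr u v : irreflexive (delete_edge_rel u v).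
Proof. by move=> x; rewrite /delete_edge_rel edge_irr. Qed.

Definition delete_edge u v : sgraph n :=
  SGraph (delete_edge_sym u v) (delete_edge_irr u v).

(* After the removal of v, the remaining vertices are renumbered by 'I_n.-1:
   x : 'I_n.-1 stands for the old vertex lift v x. *)
Definition delete_vertex_rel (v : 'I_n) : rel 'I_n.-1 :=
  fun x y => H (lift v x) (lift v y).

Lemma delete_vertex_sym v : symmetric (delete_vertex_rel v).
Proof. by move=> x y; rewrite /delete_vertex_rel edge_sym. Qed.

Lemma delete_vertex_irr v : irreflexive (delete_vertex_rel v).
Proof. by move=> x; rewrite /delete_vertex_rel edge_irr. Qed.

Definition delete_vertex v : sgraph n.-1 :=
  SGraph (delete_vertex_sym v) (delete_vertex_irr v).

(* Contraction of uv: v is identified with u, and the classes {u, v} and {w}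
   (w <> u, v) are named by u and w, then renumbered as for delete_vertex. *)
Definition identify (u v x : 'I_n) : 'I_n := if x == v then u else x.

Definition contract_rel (u v : 'I_n) : rel 'I_n.-1 :=
  fun x y => (x != y) &&
    [exists a, exists b,
      [&& identify u v a == lift v x, identify u v b == lift v y & H a b]].

Lemma contract_sym u v : symmetric (contract_rel u v).
Proof.
move=> x y; rewrite /contract_rel eq_sym; congr (_ && _).
by apply/existsP/existsP => -[a /existsP[b /and3P[ha hb hab]]];
  exists b; apply/existsP; exists a; rewrite ha hb edge_sym.
Qed.

Lemma contract_irr u v : irreflexive (contract_rel u v).
Proof. by move=> x; rewrite /contract_rel eqxx. Qed.

Definition contract u v : sgraph n.-1 :=
  SGraph (contract_sym u v) (contract_irr u v).

End Operations.

Definition rooted_iso (G H : rooted_graph) : Prop :=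
  exists f : 'I_(rg_order G) -> 'I_(rg_order H),
    [/\ bijective f,
        f (rg_root G) = rg_root H
      & forall x y, rg_graph H (f x) (f y) = rg_graph G x y].

(* minor_step G H: G results from H by a single operation. *)
Inductive minor_step : rooted_graph -> rooted_graph -> Prop :=
| StepDeleteEdge n (H : sgraph n) (i u v : 'I_n) :
    H u v ->
    minor_step (RootedGraph (delete_edge H u v) i) (RootedGraph H i)
| StepDeleteVertex n (H : sgraph n) (i v : 'I_n) (j : 'I_n.-1) :
    v != i -> (forall w, ~~ H v w) -> lift v j = i ->
    minor_step (RootedGraph (delete_vertex H v) j) (RootedGraph H i)
| StepContract n (H : sgraph n) (i u v : 'I_n) (j : 'I_n.-1) :
    H u v -> lift v j = identify u v i ->
    minor_step (RootedGraph (contract H u v) j) (RootedGraph H i).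

(* rooted_minor G H: G is a rooted minor of H, up to relabelling vertices. *)
Inductive rooted_minor : rooted_graph -> rooted_graph -> Prop :=
| MinorIso G H : rooted_iso G H -> rooted_minor G H
| MinorStep G K H : rooted_minor G K -> minor_step K H -> rooted_minor G H.

Local Open Scope ring_scope.

Section Matrices.
Variable R : realType.

Definition symmetric_mx n (A : 'M[R]_n) : Prop := A^T = A.

Definition in_S n (G : sgraph n) (A : 'M[R]_n) : Prop :=
  symmetric_mx A /\ forall j k : 'I_n, j != k -> (A j k != 0) = G j k.

Definition nullity n (A : 'M[R]_n) : nat := \rank (cokermx A).

Definition principal_delete n (i : 'I_n) (A : 'M[R]_n) : 'M[R]_n.-1 :=
  row' i (col' i A).

Definition nullity_pair n (i : 'I_n) (A : 'M[R]_n) : nat * nat :=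
  (nullity A, nullity (principal_delete i A)).

Definition hadamard n (A B : 'M[R]_n) : 'M[R]_n := map2_mx *%R A B.

Definition SNIP n (i : 'I_n) (A : 'M[R]_n) : Prop :=
  symmetric_mx A /\
  forall X : 'M[R]_n, symmetric_mx X ->
    hadamard A X = 0 -> hadamard 1%:M X = 0 -> row' i (A *m X) = 0 ->
    X = 0.

Definition allows_with_SNIP (G : rooted_graph) (k l : nat) : Prop :=
  exists A : 'M[R]_(rg_order G),
    [/\ in_S (rg_graph G) A,
        nullity_pair (rg_root G) A = (k, l)
      & SNIP (rg_root G) A].

End Matrices.

(* Main.v *)
From HB Require Import structures.
Require Import Defs.
From mathcomp Require Import all_boot all_order all_algebra perm.
From mathcomp Require Import boolp classical_sets functions interval_inference.
From mathcomp Require Import reals topology normedtype sequences.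
From mathcomp Require Import ring lra.

Set Implicit Arguments.
Unset Strict Implicit.
Unset Printing Implicit Defensive.

Import Order.TTheory GRing.Theory Num.Theory.
Import numFieldNormedType.Exports.

Local Open Scope ring_scope.

(** It suffices to undo one minor operation. Congruence by 1 + K, where row i of
    K vanishes off the diagonal, preserves the i-nullity pair. The orthogonal
    complement of the tangent space {K^T A + A K} of such congruences consists
    of the symmetric X with A X zero outside row i and (A X)_ii = 0; the latter
    equation is automatic when A o X = 0. Hence A has the i-SNIP iff
    K |-> K^T A + A K is onto the symmetric matrices supported on the nonedges,
    and a Banach fixed point then produces matrices near A with the same
    nullity pair and any small prescribed entries on the nonedges. A
    quantitative form of injectivity shows that they still have the SNIP.
    - Adding back an edge prescribes one small nonzero nonedge entry.
    - An isolated vertex is added as a direct summand 1.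
    - An edge uv contracted to u is restored by a matrix whose Schur complement
      at v is close to A, with an entry of size 1/e at uv. *)

(** * Fixed points of contractions on matrices *)

HB.instance Definition _ (R : realType) m n := Complete.on 'M[R]_(m, n).

(** The ball of radius [r] is stable, as |F X| <= |X| / 2 + |F 0| <= r, so Banach's theorem applies
    on it. *)
Lemma norm_fixpoint (R : realType) m n (F : 'M[R]_(m, n) -> 'M[R]_(m, n))
    (r : R) :
    0 < r ->
    (forall X Y, `|X| <= r -> `|Y| <= r -> `|F X - F Y| <= `|X - Y| / 2) ->
    `|F 0| <= r / 2 ->
  exists2 X, `|X| <= r & F X = X.
Proof.
move=> r0 cF F0.
pose U : set 'M[R]_(m, n) := closed_ball 0 r.
have UE X : U X <-> `|X| <= r.
  by rewrite /U closed_ballE// /closed_ball_ /= sub0r normrN.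
have UF : set_fun U U F.
  move=> X /UE Xr; apply/UE.
  have := cF X 0 Xr; rewrite normr0 subr0 => /(_ (ltW r0)) h.
  rewrite -(subrK (F 0) (F X)) (le_trans (ler_normD _ _))//.
  by move: h F0 Xr; lra.
have h0 : 0 <= 2^-1 :> R by rewrite invr_ge0.
have [|||X /UE Xr FX] := @banach_fixed_point _ _ U (mkfun_fun UF).
- exists (NngNum h0); split=> /=; first by rewrite invf_lt1// ltr1n.
  by move=> [X Y] [/= /UE Xr /UE Yr]; rewrite mulrC; exact: cF.
- exact: closed_ball_closed.
- by exists 0; apply/UE; rewrite normr0 ltW.
- by exists X.
Qed.

(** * The entrywise maximum norm *)

Section MatrixNorm.
Variable R : realType.

Lemma norm_mx_le m n (A : 'M[R]_(m, n)) (c : R) :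
  0 <= c -> (forall x y, `|A x y| <= c) -> `|A| <= c.
Proof.
move=> c0 Ac; rewrite [leLHS]/Num.Def.normr /= mx_normrE.
by apply: bigmax_le => // -[x y] _; exact: Ac.
Qed.

Lemma norm_entry m n (A : 'M[R]_(m, n)) x y : `|A x y| <= `|A|.
Proof.
rewrite [leRHS]/Num.Def.normr /= mx_normrE.
by apply/bigmax_geP; right; exists (x, y).
Qed.

Lemma norm_trmx m n (A : 'M[R]_(m, n)) : `|A^T| = `|A|.
Proof.
have le p q (B : 'M[R]_(p, q)) : `|B^T| <= `|B|.
  by apply: norm_mx_le => // x y; rewrite mxE norm_entry.
by apply/eqP; rewrite eq_le le -{1}[A]trmxK le.
Qed.

Lemma norm_mulmx m n p (A : 'M[R]_(m, n)) (B : 'M[R]_(n, p)) :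
  `|A *m B| <= n%:R * (`|A| * `|B|).
Proof.
apply: norm_mx_le => [|x y]; first by rewrite !mulr_ge0.
rewrite mxE (le_trans (ler_norm_sum _ _ _))//.
rewrite mulr_natl -[X in _ *+ X]card_ord -sumr_const ler_sum// => z _.
by rewrite normrM ler_pM// norm_entry.
Qed.

Lemma norm_mxvec m n (A : 'M[R]_(m, n)) : `|mxvec A| <= `|A|.
Proof.
apply: norm_mx_le => // x y.
by case/mxvec_indexP: y => i j; rewrite ord1 mxvecE norm_entry.
Qed.

Lemma norm_vec_mx m n (u : 'rV[R]_(m * n)) : `|vec_mx u| <= `|u|.
Proof. by apply: norm_mx_le => // x y; rewrite mxE norm_entry. Qed.

(** If v (1 + K) = 0 then v = - v K, so |v| <= n |K| |v|, which forces v = 0. *)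
Lemma unitmx_1D n (K : 'M[R]_n) : n%:R * `|K| < 1 -> 1%:M + K \in unitmx.
Proof.
move=> K1; rewrite -row_free_unit -kermx_eq0.
apply/eqP/row_matrixP => x; rewrite row0; set v := row x _.
have vK : v *m (1%:M + K) = 0.
  by rewrite /v -row_mul mulmx_ker row0.
have {}vK : v = - (v *m K) by apply/eqP;
  rewrite -addr_eq0 -{1}[v]mulmx1 -mulmxDr vK.
apply/eqP; rewrite -normr_le0.
have := norm_mulmx v K; rewrite -(normrN (v *m K)) -vK.
have := normr_ge0 v; have := normr_ge0 K; nra.
Qed.

Lemma nonzero_entries_bound m n (A : 'M[R]_(m, n)) :
  exists2 d, 0 < d & forall x y, A x y != 0 -> d < `|A x y|.
Proof.
(* Since 0^-1 = 0, zero entries add nothing to [s]; passing to [s + 1] makes the bound strict and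
   covers [s = 0]. *)
pose s := \sum_x \sum_y `|A x y|^-1.
have s0 : 0 <= s by do 2!apply: sumr_ge0 => ? _; rewrite invr_ge0.
have s1 : 0 < s + 1 by rewrite ltr_wpDl.
exists (s + 1)^-1 => [|x y Axy]; first by rewrite invr_gt0.
rewrite invf_plt ?posrE ?normr_gt0// (@le_lt_trans _ _ s) ?ltrDl//.
rewrite /s (bigD1 x)//= (bigD1 y)//= -addrA lerDl addr_ge0//.
  by apply: sumr_ge0 => ? _; rewrite invr_ge0.
by do 2!apply: sumr_ge0 => ? _; rewrite invr_ge0.
Qed.

End MatrixNorm.

(** * Adjoint linear maps on matrices *)

Section Duality.
Variable F : fieldType.

Lemma mxvec_dot m n (X Y : 'M[F]_(m, n)) :
  mxvec X *m (mxvec Y)^T = (\sum_x \sum_y X x y * Y x y)%:M.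
Proof.
rewrite [LHS]mx11_scalar mxE pair_bigA /=; congr (_%:M).
rewrite (reindex _ (curry_mxvec_bij _ _)) /=.
by apply: eq_bigr => -[x y] _; rewrite mxE !mxvecE.
Qed.

Lemma mulrmx_inj m n (P Q : 'M[F]_(m, n)) :
  (forall u : 'rV_m, u *m P = u *m Q) -> P = Q.
Proof. by move=> PQ; apply/row_matrixP => x; rewrite !rowE PQ. Qed.

Definition adjoint n (f g : 'M[F]_n -> 'M[F]_n) :=
  forall X Y : 'M[F]_n,
    \sum_x \sum_y f X x y * Y x y = \sum_x \sum_y X x y * g Y x y.

(** [mxvec] turns the entrywise pairing into the dot product of row vectors, for which adjoints are
    transposes. *)
Lemma lin_mx_adjoint n (f g : {linear 'M[F]_n -> 'M[F]_n}) :
  adjoint f g -> (lin_mx f)^T = lin_mx g.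
Proof.
move=> fg; apply: mulrmx_inj => u; apply: trmx_inj; apply: mulrmx_inj => v.
rewrite -[u]vec_mxK -[v]vec_mxK mul_vec_lin mxvec_dot -fg -mxvec_dot.
by rewrite trmx_mul trmxK mulmxA mul_vec_lin.
Qed.

(* Injectivity of f modulo p dualizes to surjectivity of its adjoint g onto the
   image of p. *)
Lemma adjoint_factor n (f g p : {linear 'M[F]_n -> 'M[F]_n}) :
    adjoint f g -> adjoint p p -> (forall X, f X = 0 -> p X = 0) ->
  exists Z : 'M[F]_(n * n),
    (forall X, p X = vec_mx (mxvec (f X) *m Z)) /\
    (forall X, g (vec_mx (mxvec X *m Z^T)) = p X).
Proof.
move=> /lin_mx_adjoint fg /lin_mx_adjoint pp fp.
(* Row vectors killed by [lin_mx f] are killed by [lin_mx p]; for the transposes this is an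
   inclusion of row spaces. *)
have : ((lin_mx p)^T <= (lin_mx f)^T)%MS.
  rewrite submxE; set C := cokermx _; apply/eqP/trmx_inj.
  rewrite trmx_mul trmxK trmx0.
  have : C^T *m lin_mx f = 0.
    by rewrite -[lin_mx f]trmxK -trmx_mul mulmx_coker trmx0.
  move=> Cf; apply/row_matrixP => x; rewrite row0 row_mul.
  have := congr1 (row x) Cf; rewrite row0 row_mul.
  rewrite -[row x C^T]vec_mxK !mul_vec_lin => /eqP.
  by rewrite mxvec_eq0 => /eqP/fp->; rewrite linear0.
(* From p^T = D f^T come p = f D^T, the first identity, and, as p^T = p and f^T = g, also p = D g,
   the second. *)
case/submxP => D pD; exists D^T; split=> X.
  by rewrite -mul_vec_lin -mulmxA -[lin_mx f]trmxK -trmx_mul -pD trmxK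
    mul_vec_lin mxvecK.
apply: (can_inj mxvecK); rewrite -mul_vec_lin vec_mxK trmxK -mulmxA -fg -pD.
by rewrite pp mul_vec_lin.
Qed.

End Duality.

(** * The linear maps that express the SNIP *)

Section Adjoints.
Variable R : realType.

Lemma adjoint_comp n (f g f' g' : 'M[R]_n -> 'M[R]_n) :
  adjoint f g -> adjoint f' g' -> adjoint (f \o f') (g' \o g).
Proof. by move=> fg fg' X Y /=; rewrite fg fg'. Qed.

Lemma adjoint_mulmx n (A : 'M[R]_n) : adjoint (mulmx A) (mulmx A^T).
Proof.
have trE (P Q : 'M[R]_n) : \sum_x \sum_y P x y * Q x y = \tr (P *m Q^T).
  by apply: eq_bigr => x _; rewrite mxE; apply: eq_bigr => y _; rewrite mxE.
move=> X Y; rewrite !trE trmx_mul trmxK -mulmxA mxtrace_mulC.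
by rewrite -mulmxA.
Qed.

Definition nonedge n (G : sgraph n) x y := (x != y) && ~~ G x y.

Lemma nonedgeC n (G : sgraph n) x y : nonedge G x y = nonedge G y x.
Proof. by rewrite /nonedge eq_sym edge_sym. Qed.

(** The orthogonal projection onto the symmetric X with A o X = 0 and I o X = 0, for any A in
    S(G). *)
Definition nonedge_part n (G : sgraph n) (X : 'M[R]_n) : 'M[R]_n :=
  \matrix_(x, y) if nonedge G x y then (X x y + X y x) / 2 else 0.

(** Being self-adjoint, this projection both selects the equations on A X and constrains the
    congruence directions K. *)
Definition root_mask n (i : 'I_n) (Y : 'M[R]_n) : 'M[R]_n :=
  \matrix_(x, y) if (x == i) && (y != i) then 0 else Y x y.

Lemma nonedge_part_is_linear n (G : sgraph n) : linear (nonedge_part G).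
Proof.
by move=> a X Y; apply/matrixP=> x y; rewrite !mxE; case: ifP => _; field.
Qed.
HB.instance Definition _ n (G : sgraph n) :=
  GRing.isLinear.Build R 'M[R]_n 'M[R]_n _ (nonedge_part G)
    (nonedge_part_is_linear G).

Lemma root_mask_is_linear n (i : 'I_n) : linear (root_mask i).
Proof.
by move=> a X Y; apply/matrixP=> x y; rewrite !mxE; case: ifP => _; ring.
Qed.
HB.instance Definition _ n (i : 'I_n) :=
  GRing.isLinear.Build R 'M[R]_n 'M[R]_n _ (root_mask i)
    (root_mask_is_linear i).

Lemma adjoint_nonedge_part n (G : sgraph n) :
  adjoint (nonedge_part G) (nonedge_part G).
Proof.
move=> X Y; pose c x y : R := if nonedge G x y then 2^-1 else 0.
have cE (P Q : 'M[R]_n) : \sum_x \sum_y nonedge_part G P x y * Q x y =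
    \sum_x \sum_y c x y * (P x y * Q x y) +
    \sum_x \sum_y c x y * (P y x * Q x y).
  rewrite -big_split; apply: eq_bigr => x _ /=; rewrite -big_split.
  by apply: eq_bigr => y _; rewrite /= mxE /c; case: ifP => _; field.
rewrite cE (eq_bigr _ (fun x _ => eq_bigr _ (fun y _ => mulrC (X x y) _))) cE.
congr (_ + _); first by do 2!apply: eq_bigr => ? _; rewrite [X in _ * X]mulrC.
rewrite exchange_big; do 2!apply: eq_bigr => ? _.
by rewrite /c nonedgeC [X in _ * X]mulrC.
Qed.

Lemma adjoint_root_mask n (i : 'I_n) : adjoint (root_mask i) (root_mask i).
Proof.
move=> X Y; do 2!apply: eq_bigr => ? _.
by rewrite !mxE; case: ifP; rewrite ?mul0r ?mulr0.
Qed.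

Lemma nonedge_part_tr n (G : sgraph n) X :
  nonedge_part G X^T = nonedge_part G X.
Proof. by apply/matrixP=> x y; rewrite !mxE addrC. Qed.

Lemma tr_nonedge_part n (G : sgraph n) X :
  (nonedge_part G X)^T = nonedge_part G X.
Proof. by apply/matrixP=> x y; rewrite !mxE nonedgeC addrC. Qed.

Lemma nonedge_partK n (G : sgraph n) X :
  nonedge_part G (nonedge_part G X) = nonedge_part G X.
Proof.
apply/matrixP=> x y; rewrite !mxE (nonedgeC G y x).
case: (nonedge G x y) => //.
by field.
Qed.

Lemma norm_nonedge_part n (G : sgraph n) X : `|nonedge_part G X| <= `|X|.
Proof.
apply: norm_mx_le => // x y; rewrite mxE.
case: ifP => _; last by rewrite normr0.
rewrite normrM (@ger0_norm _ 2^-1)// ler_pdivrMr//.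
have := ler_normD (X x y) (X y x).
by have := norm_entry X x y; have := norm_entry X y x; lra.
Qed.

Lemma norm_root_mask n (i : 'I_n) (X : 'M[R]_n) : `|root_mask i X| <= `|X|.
Proof.
apply: norm_mx_le => // x y; rewrite mxE.
by case: ifP => _; rewrite ?normr0// norm_entry.
Qed.

Lemma in_S_nonedge n (G : sgraph n) (A : 'M[R]_n) x y :
  in_S G A -> nonedge G x y -> A x y = 0.
Proof. by move=> [_ GA] /andP[/GA<- /negbNE/eqP]. Qed.

Lemma in_S_nonedge_part n (G : sgraph n) A : in_S G A -> nonedge_part G A = 0.
Proof.
move=> GA; apply/matrixP => x y; rewrite !mxE; case: ifP => // xy.
by rewrite !(in_S_nonedge GA) ?addr0 ?mul0r// nonedgeC.
Qed.

(** The SNIP is injectivity of X |-> [root_mask i (A *m X)] on nonedge matrices. Duality gives a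
    left inverse of this map and a right inverse of its adjoint. *)
Lemma SNIP_factor n (G : sgraph n) (i : 'I_n) (A : 'M[R]_n) :
    in_S G A -> SNIP i A ->
  exists Z : 'M[R]_(n * n),
    (forall X, nonedge_part G X =
       vec_mx (mxvec (root_mask i (A *m nonedge_part G X)) *m Z)) /\
    (forall X, nonedge_part G (A *m root_mask i (vec_mx (mxvec X *m Z^T))) =
       nonedge_part G X).
Proof.
move=> [sA GA] [_ snipA].
apply: (@adjoint_factor _ _ (root_mask i \o (mulmx A \o nonedge_part G))
  (nonedge_part G \o mulmx A \o root_mask i) (nonedge_part G)).
- apply: adjoint_comp (@adjoint_root_mask _ _) _.
  by apply: adjoint_comp (@adjoint_nonedge_part _ _); rewrite -{2}sA;
    exact: adjoint_mulmx.
- exact: adjoint_nonedge_part.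
move=> X /= /matrixP AX0; apply: snipA.
- exact: tr_nonedge_part.
- apply/matrixP => x y; rewrite !mxE; case: ifP => [xy|]; last by rewrite mulr0.
  by rewrite (@in_S_nonedge _ G A)// mul0r.
- apply/matrixP => x y; rewrite !mxE /nonedge.
  by case: (x == y); rewrite /= ?mul0r ?mulr0.
- apply/matrixP => x y; have := AX0 (lift i x) y.
  by rewrite !mxE eq_sym (negPf (neq_lift i x)).
Qed.

End Adjoints.

(** * Stability of the SNIP, and congruences preserving nullity pairs *)

Section Perturbation.
Variable R : realType.

Lemma norm_vec_mulmx n (X : 'M[R]_n) (Z : 'M[R]_(n * n)) :
  `|vec_mx (mxvec X *m Z)| <= (n * n)%:R * `|Z| * `|X|.
Proof.
rewrite (le_trans (norm_vec_mx _))// (le_trans (norm_mulmx _ _))//.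
by rewrite -mulrA ler_wpM2l// mulrC ler_wpM2l// norm_mxvec.
Qed.

(* The pattern condition on Z is only approximate because undoing a contraction
   forces zeros of Z on the edges of G up to a small multiple of Z. *)
Lemma SNIP_open n (G : sgraph n) (i : 'I_n) (A : 'M[R]_n) :
    in_S G A -> SNIP i A ->
  exists2 d : R, 0 < d & forall B Z : 'M[R]_n,
    `|B - A| <= d -> `|Z - nonedge_part G Z| <= d * `|Z| ->
    root_mask i (B *m Z) = 0 -> Z = 0.
Proof.
move=> GA /(SNIP_factor GA)[M [Mleft _]].
set c := (n * n)%:R * `|M|; set N : R := n%:R.
have c0 : 0 <= c by rewrite mulr_ge0.
have N0 : 0 <= N by [].
(* Chosen so that the final estimate reads |Z| <= d C |Z| = |Z| / 2. *)
set C := 1 + c * (N * (`|A| + 1)).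
have C1 : 1 <= C by rewrite lerDl !mulr_ge0// addr_ge0.
have C0 : 0 < C by rewrite (lt_le_trans _ C1).
exists (2 * C)^-1 => [|B Z]; first by rewrite invr_gt0 mulr_gt0.
set d := (2 * C)^-1 => BA ZZ BZ.
have dC : d * C = 2^-1 by rewrite /d invfM -mulrA mulVf ?mulr1// gt_eqF.
have d0 : 0 <= d by rewrite invr_ge0 mulr_ge0// ltW.
set z := `|Z|; have z0 : 0 <= z := normr_ge0 Z.
set P := nonedge_part G Z in ZZ *.
(* A P = A (P - Z) + (A - B) Z + B Z: the mask kills the last term, and the others are of order d
   |Z|. *)
have maskE : root_mask i (A *m P) =
    root_mask i (A *m (P - Z)) + root_mask i ((A - B) *m Z).
  by rewrite -[RHS]addr0 -BZ -!linearD mulmxBr mulmxBl addrA addrNK subrK.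
have le1 : `|A *m (P - Z)| <= N * (`|A| * (d * z)).
  rewrite (le_trans (norm_mulmx _ _))// !ler_wpM2l//.
  by rewrite -normrN opprB.
have le2 : `|(A - B) *m Z| <= N * (d * z).
  by rewrite (le_trans (norm_mulmx _ _))// ler_wpM2l// ler_wpM2r//
    -normrN opprB.
have le3 : `|root_mask i (A *m P)| <= N * (`|A| * (d * z)) + N * (d * z).
  rewrite maskE (le_trans (ler_normD _ _))// lerD//;
    exact: le_trans (norm_root_mask _ _) _.
have le4 : `|P| <= c * (N * (`|A| * (d * z)) + N * (d * z)).
  by rewrite /P Mleft (le_trans (norm_vec_mulmx _ _))// ler_wpM2l.
apply/eqP; rewrite -normr_le0 -/z.
have : z <= d * z + c * (N * (`|A| * (d * z)) + N * (d * z)).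
  by rewrite {1}/z -{1}(subrK P Z) (le_trans (ler_normD _ _))// lerD.
have -> : d * z + c * (N * (`|A| * (d * z)) + N * (d * z)) = d * C * z.
  by rewrite /C; ring.
by rewrite dC; lra.
Qed.

Lemma nullity_congr n (P A : 'M[R]_n) :
  P \in unitmx -> nullity (P^T *m A *m P) = nullity A.
Proof.
move=> uP; rewrite /nullity !mxrank_coker mxrankMfree ?row_free_unit//.
by rewrite -mxrank_tr trmx_mul trmxK mxrankMfree ?row_free_unit// mxrank_tr.
Qed.

(** For x and y other than i, [P i x] and [P i y] vanish, so the index i drops out of both sums. *)
Lemma principal_delete_congr n (i : 'I_n) (P A : 'M[R]_n) :
    (forall y, y != i -> P i y = 0) ->
  principal_delete i (P^T *m A *m P) =
  (principal_delete i P)^T *m principal_delete i A *m principal_delete i P.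
Proof.
move=> Pi0; apply/matrixP => x y; rewrite !mxE (bigD1_ord i)//=.
rewrite Pi0 ?mulr0 ?add0r; last by rewrite eq_sym neq_lift.
apply: eq_bigr => z _; rewrite !mxE; congr (_ * _).
rewrite (bigD1_ord i)//= mxE Pi0 ?mul0r ?add0r; last by rewrite eq_sym neq_lift.
by apply: eq_bigr => w _; rewrite !mxE.
Qed.

Lemma nullity_pair_congr n (i : 'I_n) (K A : 'M[R]_n) :
    (forall y, y != i -> K i y = 0) -> n%:R * `|K| < 1 ->
  nullity_pair i ((1%:M + K)^T *m A *m (1%:M + K)) = nullity_pair i A.
Proof.
move=> Ki0 K1; congr (_, _); first by rewrite nullity_congr// unitmx_1D.
rewrite principal_delete_congr; last first.
  by move=> y yi; rewrite !mxE Ki0// addr0 eq_sym (negPf yi).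
have -> : principal_delete i (1%:M + K) = 1%:M + principal_delete i K.
  by apply/matrixP => x y; rewrite !mxE (inj_eq (@lift_inj _ i)).
rewrite nullity_congr// unitmx_1D// (le_lt_trans _ K1)// ler_pM//.
  by rewrite ler_nat leq_pred.
by apply: norm_mx_le => // x y; rewrite !mxE norm_entry.
Qed.

End Perturbation.

(** * Prescribing small entries on the nonedges *)

Section Perturb.
Variable R : realType.

(** With C a sum of nonnegative constants, a single bound on t yields one estimate for each
    summand. *)
Lemma ler_mul_small (C e t x : R) :
  0 <= C -> 0 <= t <= e / (1 + C) -> x <= 1 + C -> t * x <= e.
Proof.
move=> C0 /andP[t0]; rewrite ler_pdivlMr ?ltr_wpDr// => te xC.
by rewrite (le_trans _ te)// ler_wpM2l.
Qed.

Lemma norm_congr n (X A Y : 'M[R]_n) (x y : R) :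
    `|X| <= x -> `|Y| <= y ->
  `|X^T *m A *m Y| <= n%:R * (n%:R * (x * `|A|) * y).
Proof.
move=> Xx Yy; rewrite (le_trans (norm_mulmx _ _))// ler_wpM2l// ler_pM//.
by rewrite (le_trans (norm_mulmx _ _))// ler_wpM2l// ler_wpM2r// norm_trmx.
Qed.

(* The matrices (1 + K)^T A (1 + K) with K i y = 0 for y != i have the nullity
   pair of A. Under the SNIP, K |-> A K + K^T A reaches every symmetric matrix
   on the nonedges, so the prescribed entries are attained by a fixed point. *)
Lemma SNIP_perturb n (G : sgraph n) (i : 'I_n) (A : 'M[R]_n)
    (W : 'M[R]_n -> 'M[R]_n) (L : R) :
    in_S G A -> SNIP i A ->
    (forall B, B^T = B -> (W B)^T = W B) ->
    0 <= L ->
    (forall B B', `|B - A| <= 1 -> `|B' - A| <= 1 ->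
      `|W B - W B'| <= L * `|B - B'|) ->
  forall d : R, 0 < d ->
  exists2 t0 : R, 0 < t0 & forall t, 0 < t <= t0 ->
    exists B : 'M[R]_n,
      [/\ B^T = B, `|B - A| <= d, nullity_pair i B = nullity_pair i A
        & forall x y, nonedge G x y -> B x y = t * W B x y].
Proof.
move=> GA snipA Wsym L0 WL d d0.
have sA : A^T = A by case: GA.
have [M [_ Mright]] := SNIP_factor GA snipA.
(* The direction K = [s T] solves the linearized problem: A K and its transpose each have half of
   the nonedge part of T. *)
pose s (T : 'M[R]_n) := root_mask i (vec_mx (mxvec (2^-1 *: T) *m M^T)).
set N : R := n%:R; set a := `|A|.
set c := (n * n)%:R * `|M^T|.
have c0 : 0 <= c by rewrite mulr_ge0.
have N0 : 0 <= N by rewrite /N.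
have a0 : 0 <= a := normr_ge0 A.
have sB T T' : s (T - T') = s T - s T'.
  by rewrite /s scalerBr linearB /= mulmxBl !linearB.
have s0 : s 0 = 0 by rewrite /s scaler0 linear0 mul0mx !linear0.
have s_norm T : `|s T| <= c * `|T|.
  rewrite (le_trans (norm_root_mask _ _))// (le_trans (norm_vec_mulmx _ _))//.
  rewrite -/c ler_wpM2l// normrZ ler_piMl// ger0_norm ?invr_ge0//.
  by rewrite invf_le1// ler1n.
pose q T := (s T)^T *m A *m s T.
pose Bf T := (1%:M + s T)^T *m A *m (1%:M + s T).
have BfE T : Bf T = A + ((A *m s T)^T + A *m s T) + q T.
  rewrite /Bf /q [(1%:M + _)^T]linearD /= trmx1 mulmxDr !mulmxDl mulmx1 !mul1mx
    mulmx1.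
  by rewrite trmx_mul sA !addrA.
have Bfsym T : (Bf T)^T = Bf T by rewrite /Bf !trmx_mul trmxK sA mulmxA.
have partB T : nonedge_part G (Bf T) = nonedge_part G T + nonedge_part G (q T).
  rewrite BfE !linearD /= (in_S_nonedge_part GA) add0r nonedge_part_tr.
  rewrite /s Mright linearZ /=; congr (_ + _).
  by rewrite -scalerDl -[RHS]scale1r; congr (_ *: _); field.
pose E := 2 * (N * (N * (c * a) * c)).
have E0 : 0 <= E by rewrite !mulr_ge0.
(* The remainder is quadratic, so its Lipschitz constant shrinks with the radius. *)
have q_lip r T T' : `|T| <= r -> `|T'| <= r -> `|q T - q T'| <= E * r * `|T -
  T'|.
  move=> Tr T'r.
  have -> : q T - q T' = (s (T - T'))^T *m A *m s T + (s T')^T *m A *m s (T -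
    T').
    by rewrite sB linearB /= !mulmxBl mulmxBr addrA subrK.
  rewrite (le_trans (ler_normD _ _))//.
  have sr U : `|U| <= r -> `|s U| <= c * r.
    by move=> Ur; rewrite (le_trans (s_norm _))// ler_wpM2l.
  apply: (le_trans (lerD (norm_congr A (s_norm _) (sr _ Tr))
                         (norm_congr A (sr _ T'r) (s_norm _)))).
  by rewrite le_eqVlt; apply/orP; left; apply/eqP; rewrite -/N -/a /E; ring.
pose D := 2 * (N * (a * c)) + E.
have D0 : 0 <= D by rewrite addr_ge0// !mulr_ge0.
have Bf_lip r T T' : `|T| <= r -> `|T'| <= r -> r <= 1 ->
    `|Bf T - Bf T'| <= D * `|T - T'|.
  move=> Tr T'r r1.
  have -> : Bf T - Bf T' =
      (A *m s (T - T'))^T + A *m s (T - T') + (q T - q T').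
    rewrite !BfE sB mulmxBr linearB /= opprD addrACA; congr (_ + _).
    by rewrite opprD addrACA subrr add0r opprD addrACA.
  have As : `|A *m s (T - T')| <= N * (a * c) * `|T - T'|.
    by rewrite (le_trans (norm_mulmx _ _))// -!mulrA ler_wpM2l// ler_wpM2l//
      mulrA s_norm.
  rewrite (le_trans (ler_normD _ _))// mulrDl lerD//.
    by rewrite (le_trans (ler_normD _ _))// norm_trmx; lra.
  rewrite (le_trans (q_lip _ _ _ Tr T'r))// ler_wpM2r// -[leRHS]mulr1.
  by rewrite ler_wpM2l.
have Nc0 : 0 <= N * c by rewrite mulr_ge0.
pose C := E + D + N * c; have C0 : 0 <= C := addr_ge0 (addr_ge0 E0 D0) Nc0.
(* The cap 1/4 shares the contraction ratio 1/2 between [q] and [t *: W], and keeps n |K| < 1. *)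
pose e := Num.min d 4^-1; have e0 : 0 < e by rewrite lt_min d0 invr_gt0 ltr0n.
have ed : e <= d by rewrite ge_min lexx.
have e4 : e <= 4^-1 by rewrite ge_min lexx orbT.
pose r := e / (1 + C).
have r0 : 0 < r by rewrite divr_gt0// ltr_wpDr.
have rr : 0 <= r <= e / (1 + C) by rewrite lexx ltW.
have rE : r * E <= 4^-1.
  by rewrite (le_trans _ e4)// (ler_mul_small C0 rr)// /C; lra.
have rD : r * D <= e by rewrite (ler_mul_small C0 rr)// /C; lra.
have rN : r * (N * c) <= 4^-1.
  by rewrite (le_trans _ e4)// (ler_mul_small C0 rr)// /C; lra.
have r1 : r <= 4^-1.
  by rewrite -[r]mulr1 (le_trans _ e4)// (ler_mul_small C0 rr)// /C; lra.
have r11 : r <= 1 by move: r1; lra.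
have Bf0 : Bf 0 = A by rewrite /Bf s0 addr0 trmx1 mul1mx mulmx1.
have BfA T : `|T| <= r -> `|Bf T - A| <= e.
  move=> Tr; rewrite -Bf0 (le_trans (Bf_lip r T 0 _ _ _)) ?normr0 ?(ltW r0)//.
  by rewrite subr0 (le_trans _ rD)// mulrC ler_wpM2r.
pose C' := L * D + `|W A|.
have LD0 : 0 <= L * D by rewrite mulr_ge0.
have W0 := normr_ge0 (W A).
have C'0 : 0 <= C' by rewrite addr_ge0.
(* This gives t L D <= 1/4 for the contraction and t |W A| <= r / 4 for the size of [F 0]. *)
exists (r / 4 / (1 + C')) => [|t /andP[t0 tr]].
  by rewrite !divr_gt0// ltr_wpDr.
have {}tr : 0 <= t <= r / 4 / (1 + C') by rewrite ltW.
have tLD : t * (L * D) <= 4^-1.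
  have : t * (L * D) <= r / 4 by rewrite (ler_mul_small C'0 tr)// /C'; lra.
  by lra.
have tW : t * `|W A| <= r / 4.
  by rewrite (ler_mul_small C'0 tr)// /C'; lra.
(* By [partB], a fixed point T makes [Bf T] and [t *: W (Bf T)] agree on the nonedges. *)
pose F T := nonedge_part G (t *: W (Bf T) - q T).
have [||T Tr FT] := @norm_fixpoint _ _ _ F r r0.
- move=> T T' Tr T'r.
  have -> : F T - F T' =
      nonedge_part G (t *: (W (Bf T) - W (Bf T')) - (q T - q T')).
    rewrite scalerBr !opprD !opprK addrACA [- _ + q T']addrC -[q T' - _]opprB.
    by rewrite [RHS]linearB.
  rewrite (le_trans (norm_nonedge_part _ _))// (le_trans (ler_normB _ _))//.
  have h1 : `|t *: (W (Bf T) - W (Bf T'))| <= t * (L * D) * `|T - T'|.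
    rewrite normrZ gtr0_norm// -!mulrA ler_wpM2l ?(ltW t0)//.
    have e1 : e <= 1 by move: e4; lra.
    rewrite (le_trans (WL _ _ _ _)) ?(le_trans (BfA _ _))// ler_wpM2l//.
    exact: Bf_lip Tr T'r r11.
  have h2 := q_lip _ _ _ Tr T'r; rewrite [E * r]mulrC in h2.
  have h3 := normr_ge0 (T - T').
  have := ler_wpM2r h3 rE; have := ler_wpM2r h3 tLD; lra.
- rewrite /F Bf0 /q s0 mulmx0 subr0 (le_trans (norm_nonedge_part _ _))//.
  by rewrite normrZ gtr0_norm//; move: tW r0; lra.
exists (Bf T); split=> //.
- by rewrite (le_trans (BfA _ Tr)).
- apply: nullity_pair_congr => [y yi|]; first by rewrite mxE eqxx yi.
  have := s_norm T; have := ler_wpM2l c0 Tr => h1 h2.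
  have : N * `|s T| <= N * (c * r) by rewrite ler_wpM2l// (le_trans h2).
  by move: rN; rewrite -/N; lra.
- move=> x y xy.
  have : nonedge_part G (Bf T) = nonedge_part G (t *: W (Bf T)).
    have TT : nonedge_part G T = T by rewrite -FT /F nonedge_partK.
    by rewrite partB TT -[t *: _](subrK (q T)) linearD /= -/(F T) FT.
  move/matrixP/(_ x y).
  rewrite ![nonedge_part G _ _ _]mxE xy ![(t *: W (Bf T)) _ _]mxE.
  have symE (P : 'M[R]_n) : P^T = P -> P y x = P x y.
    by move=> /matrixP/(_ x y); rewrite mxE.
  by rewrite !(symE (W _)) ?Wsym// (symE (Bf T))//; lra.
Qed.

End Perturb.

(** * The SNIP in terms of entries *)

Section SnipEntries.
Variable R : realType.

Lemma SNIP_entries n (i : 'I_n) (A X : 'M[R]_n) :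
    SNIP i A -> X^T = X ->
    (forall x y, A x y * X x y = 0) -> (forall x, X x x = 0) ->
    (forall x y, x != i -> (A *m X) x y = 0) ->
  X = 0.
Proof.
move=> [_ snipA] sX AX dX rX; apply: snipA => //.
- by apply/matrixP => x y; rewrite !mxE AX.
- apply/matrixP => x y; rewrite !mxE.
  by have [->|_] := eqVneq x y; rewrite ?dX ?mulr0 ?mul0r.
- apply/matrixP => x y; rewrite [LHS]mxE rX ?[RHS]mxE//.
  by rewrite eq_sym neq_lift.
Qed.

Lemma SNIP_intro n (i : 'I_n) (A : 'M[R]_n) :
    A^T = A ->
    (forall X : 'M[R]_n, X^T = X ->
      (forall x y, A x y * X x y = 0) -> (forall x, X x x = 0) ->
      (forall x y, x != i -> (A *m X) x y = 0) -> X = 0) ->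
  SNIP i A.
Proof.
move=> sA snipA; split=> // X sX /matrixP AX /matrixP IX /matrixP rX.
apply: snipA => //.
- by move=> x y; have := AX x y; rewrite !mxE.
- by move=> x; have := IX x x; rewrite !mxE eqxx mul1r.
- move=> x y; rewrite eq_sym => /unlift_some[z -> _].
  by have := rX z y; rewrite [LHS]mxE [RHS]mxE.
Qed.

Lemma trmx_entry n (X : 'M[R]_n) x y : X^T = X -> X x y = X y x.
Proof. by move=> /matrixP/(_ x y) <-; rewrite mxE. Qed.

(** By symmetry of X each term A x z X z x vanishes. At the root this is the equation that
    [root_mask] keeps beyond the SNIP. *)
Lemma mulmx_diag_hadamard0 n (A X : 'M[R]_n) x :
  X^T = X -> (forall x y, A x y * X x y = 0) -> (A *m X) x x = 0.
Proof.
by move=> sX AX; rewrite mxE big1// => z _; rewrite (trmx_entry z x sX) AX.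
Qed.

End SnipEntries.

(** * Invariance under isomorphism *)

Section Isomorphism.
Variable R : realType.

Lemma rank_mxsub_le m n p q (f : 'I_p -> 'I_m) (g : 'I_q -> 'I_n)
    (A : 'M[R]_(m, n)) :
  (\rank (mxsub f g A) <= \rank A)%N.
Proof.
have rle k l j (h : 'I_j -> 'I_k) (B : 'M[R]_(k, l)) :
    (\rank (rowsub h B) <= \rank B)%N.
  by apply/mxrankS/row_subP => x; rewrite row_rowsub row_sub.
have -> : mxsub f g A = rowsub f (rowsub g A^T)^T.
  by apply/matrixP => x y; rewrite !mxE.
by rewrite (leq_trans (rle _ _ _ _ _))//
  mxrank_tr (leq_trans (rle _ _ _ _ _))// mxrank_tr.
Qed.

(** Only j can be sent to i, so g induces a map h between the remaining indices. Inverse bijections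
    then give equal ranks. *)
Lemma rank_principal_delete_mxsub_le m n (i : 'I_m) (j : 'I_n)
    (g : 'I_n -> 'I_m) (A : 'M[R]_m) :
    (forall x, g x = i -> x = j) ->
  (\rank (principal_delete j (mxsub g g A)) <= \rank (principal_delete i A))%N.
Proof.
move=> gij.
have hP x : {y | g (lift j x) = lift i y}.
  have /unlift_some[y gy _] : i != g (lift j x); last by exists y.
  by rewrite eq_sym; apply/negP => /eqP/gij/eqP;
    rewrite eq_sym (negPf (neq_lift _ _)).
pose h x := sval (hP x).
suff -> : principal_delete j (mxsub g g A) = mxsub h h (principal_delete i A).
  exact: rank_mxsub_le.
by apply/matrixP => x y; rewrite !mxE (svalP (hP x)) (svalP (hP y)).
Qed.

Lemma allows_with_SNIP_iso (G H : rooted_graph) k l :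
  rooted_iso G H -> allows_with_SNIP R G k l -> allows_with_SNIP R H k l.
Proof.
case: G H => m G i [n H j] /= [f [[g fK gK] /= fi fH]] [A [/= GA nA snipA]].
have mn : m = n.
  by rewrite -(card_ord m) -(card_ord n); apply: bij_eq_card; exists g.
pose B := mxsub g g A; have AE : A = mxsub f f B.
  by apply/matrixP => x y; rewrite !mxE !fK.
have BE x y : B (f x) (f y) = A x y by rewrite mxE !fK.
have sB : B^T = B.
  by case: GA => sA _; apply/matrixP => x y; rewrite !mxE (trmx_entry _ _ sA).
have rk : \rank B = \rank A.
  by apply/eqP; rewrite eqn_leq rank_mxsub_le [in X in _ && X]AE rank_mxsub_le.
have rk' : \rank (principal_delete j B) = \rank (principal_delete i A).
  apply/eqP; rewrite eqn_leq; apply/andP; split.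
    by apply: rank_principal_delete_mxsub_le => x gx; rewrite -fi -gx gK.
  rewrite [in X in (X <= _)%N]AE.
  by apply: rank_principal_delete_mxsub_le => x fx; apply: (can_inj fK);
    rewrite fx fi.
exists B; split=> /=.
- split=> // x y xy; rewrite -(gK x) -(gK y) BE fH; case: GA => _; apply.
  by rewrite (can_eq gK).
- by rewrite -nA /nullity_pair /nullity !mxrank_coker rk rk' -mn.
apply: SNIP_intro => // X sX BX dX rX.
have : mxsub f f X = 0.
  apply: (SNIP_entries snipA) => [|x y|x|x y xi].
  - by apply/matrixP => x y; rewrite !mxE (trmx_entry _ _ sX).
  - by rewrite -BE [X in _ * X]mxE BX.
  - by rewrite mxE dX.
  - rewrite -(rX (f x) (f y)); last by rewrite -fi (can_eq fK).
    rewrite !mxE (reindex f) /=; last by exists g => z _.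
    by apply: eq_bigr => z _; rewrite mxE BE.
move=> /matrixP X0; apply/matrixP => x y.
by have := X0 (g x) (g y); rewrite !mxE !gK.
Qed.

End Isomorphism.

(** * Undoing an edge deletion *)

Section AddEdge.
Variable R : realType.

(** A constant target [E], hence L = 0, yields B with entry t at uv and 0 at the other nonedges of
    G. A test matrix X for B vanishes on the edges of G, so it is its own nonedge part and
    [SNIP_open] applies. *)
Lemma allows_with_SNIP_add_edge n (H : sgraph n) (i u v : 'I_n) k l :
    H u v ->
    allows_with_SNIP R (RootedGraph (delete_edge H u v) i) k l ->
  allows_with_SNIP R (RootedGraph H i) k l.
Proof.
move=> Huv [A [/= GA nA snipA]]; set G := delete_edge H u v in GA.
pose E : 'M[R]_n := \matrix_(x, y) ([set x; y] == [set u; v])%:R.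
have sE : E^T = E by apply/matrixP => x y; rewrite !mxE finset.setUC.
have [d1 d10 open_d1] := SNIP_open GA snipA.
have [d2 d20 bound_d2] := nonzero_entries_bound A.
(* [d1] preserves the SNIP, [d2] keeps nonzero entries nonzero. *)
pose d := Num.min d1 d2; have d0 : 0 < d by rewrite lt_min d10.
have [t t0 /(_ t)] : exists2 t0 : R, 0 < t0 & forall t, 0 < t <= t0 ->
    exists B : 'M[R]_n,
      [/\ B^T = B, `|B - A| <= d, nullity_pair i B = nullity_pair i A
        & forall x y, nonedge G x y -> B x y = t * E x y].
  by apply: (@SNIP_perturb _ _ _ _ _ (fun=> E) 0) => // *;
    rewrite subrr normr0 mul0r.
rewrite t0 lexx => -[]// B [sB BA nB BE].
have B0 x y : G x y -> B x y != 0.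
  move=> Gxy; have xy : x != y.
    by apply: contraTneq Gxy => ->; rewrite edge_irr.
  have := bound_d2 x y; case: GA => _ ->// /(_ Gxy).
  have := norm_entry (B - A) x y; rewrite !mxE => le1.
  have dd : d <= d2 by rewrite ge_min lexx orbT.
  by apply: contraTneq => Bxy; rewrite -leNgt -normrN -sub0r -Bxy (le_trans
    le1)// (le_trans BA).
have HB x y : x != y -> (B x y != 0) = H x y.
  move=> xy; have [Gxy|nGxy] := boolP (G x y).
    by rewrite B0//; case/andP: Gxy.
  rewrite BE /nonedge ?xy// mxE.
  have [/eqP xyuv|xyuv] := boolP ([set x; y] == [set u; v]); last first.
    by rewrite mulr0 eqxx; apply/esym; apply: contraNF nGxy => Hxy;
      rewrite /= /delete_edge_rel Hxy xyuv.
  rewrite mulr1 gt_eqF//; apply/esym.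
  have : x \in [set u; v] by rewrite -xyuv set21.
  have : y \in [set u; v] by rewrite -xyuv set22.
  rewrite !inE => /orP[] /eqP yE /orP[] /eqP xE; move: xy;
    rewrite xE yE ?eqxx ?Huv//.
  by rewrite edge_sym Huv.
exists B; split=> //=; first by rewrite nB.
apply: SNIP_intro => // X sX BX dX rX.
apply: (open_d1 B).
- by rewrite (le_trans BA)// ge_min lexx.
- suff -> : nonedge_part G X = X by rewrite subrr normr0 mulr_ge0// ltW.
  apply/matrixP => x y; rewrite mxE (trmx_entry y x sX); case: ifPn => [_|].
    by field.
  rewrite negb_and negbK => /orP[/eqP->|]; first by rewrite dX.
  by rewrite negbK => /B0 nz; have /eqP := BX x y;
    rewrite mulf_eq0 (negPf nz) => /eqP.
- apply/matrixP => x y; rewrite [LHS]mxE [RHS]mxE; case: ifPn => //.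
  have [->|/rX->//] := eqVneq x i; rewrite negbK => /eqP->.
  exact: mulmx_diag_hadamard0.
Qed.

End AddEdge.

(** * Bordered matrices and isolated vertices *)

Section Border.
Variable R : realType.

(** The matrix with pivot 1 and Schur complement B at index 0, congruent to diag(1, B) by a
    unitriangular matrix. *)
Definition border m (r : 'rV[R]_m) (B : 'M[R]_m) : 'M[R]_m.+1 :=
  block_mx (1%:M : 'M_1) r r^T (B + r^T *m r).

Section BorderEntries.
Variables (m : nat) (r : 'rV[R]_m) (B : 'M[R]_m).

Lemma border00 : border r B ord0 ord0 = 1.
Proof.
by rewrite -[ord0](lshift0 m (@ord0 0)) /border (@block_mxEul _ 1 m 1 m) mxE.
Qed.

Lemma border0l x : border r B ord0 (lift ord0 x) = r 0 x.
Proof.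
by rewrite -rshift1 -[ord0](lshift0 m (@ord0 0)) [LHS](@block_mxEur _ 1 m 1 m).
Qed.

Lemma borderl0 x : border r B (lift ord0 x) ord0 = r 0 x.
Proof.
by rewrite -rshift1 -[ord0](lshift0 m (@ord0 0)) [LHS](@block_mxEdl _ 1 m 1 m)
  mxE.
Qed.

Lemma borderll x y :
  border r B (lift ord0 x) (lift ord0 y) = B x y + r 0 x * r 0 y.
Proof.
by rewrite -!rshift1 /border (@block_mxEdr _ 1 m 1 m) !mxE big_ord1 mxE.
Qed.

Lemma tr_border : B^T = B -> (border r B)^T = border r B.
Proof.
move=> sB; rewrite [LHS](@tr_block_mx _ 1 m 1 m) trmx1 trmxK linearD /=
  trmx_mul trmxK.
by rewrite sB.
Qed.

Lemma nullity_border : nullity (border r B) = nullity B.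
Proof.
pose Q : 'M[R]_(1 + m) := block_mx 1%:M r 0 1%:M.
have -> : border r B = Q^T *m block_mx (1%:M : 'M_1) 0 0 B *m Q.
  rewrite /Q tr_block_mx !trmx1 trmx0 !mulmx_block !mulmx1 !mul1mx !mulmx0.
  by rewrite !mul0mx !addr0 !add0r mul1mx /border addrC.
rewrite nullity_congr; last by rewrite unitmxE [\det _](@det_ublock _ 1 m)
  !det1 mulr1 unitr1.
by rewrite /nullity !mxrank_coker [\rank _](@rank_diag_block_mx _ 1 1 m m)
  mxrank1 add1n subSS.
Qed.

End BorderEntries.

Lemma principal_delete_border m (i : 'I_m.+1) r (B : 'M[R]_m.+1) :
  principal_delete (lift ord0 i) (border r B) =
  border (col' i r) (principal_delete i B).
Proof.
have l0 : lift (lift ord0 i) (@ord0 m) = ord0 by exact: val_inj.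
have ll x : lift (lift ord0 i) (lift ord0 x) = lift ord0 (lift i x).
  by apply: val_inj; rewrite /= /bump /= !add1n ltnS addnS.
apply/matrixP => x y; rewrite [LHS]mxE [LHS]mxE.
case: (unliftP ord0 x) => [x' ->|->]; case: (unliftP ord0 y) => [y' ->|->].
- by rewrite !ll !borderll !mxE.
- by rewrite !(ll, l0) !borderl0 mxE.
- by rewrite !(ll, l0) !border0l mxE.
- by rewrite !l0 !border00.
Qed.

Lemma nullity_pair_border m (i : 'I_m) r (B : 'M[R]_m) :
  nullity_pair (lift ord0 i) (border r B) = nullity_pair i B.
Proof.
case: m i r B => [[]//|m] i r B.
by rewrite /nullity_pair nullity_border principal_delete_border nullity_border.
Qed.

(** Row 0 is not the root row, so its equation gives row 0 of X as - r Z; substituted into the other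
    rows, it cancels the terms r^T r and leaves B Z. *)
Lemma border_SNIP_equations m (i : 'I_m) r (B : 'M[R]_m) (X : 'M[R]_m.+1) :
    let Z := principal_delete ord0 X in
    X^T = X -> (forall x y, border r B x y * X x y = 0) ->
    (forall x y, x != lift ord0 i -> (border r B *m X) x y = 0) ->
  (forall x, X ord0 (lift ord0 x) = - \sum_z r 0 z * Z z x) /\
  root_mask i (B *m Z) = 0.
Proof.
move=> Z sX BX rX.
have eq0 x : X ord0 (lift ord0 x) = - \sum_z r 0 z * Z z x.
  have := rX ord0 (lift ord0 x) isT; rewrite mxE big_ord_recl border00 mul1r.
  move/eqP; rewrite addr_eq0 => /eqP->; congr (- _).
  by apply: eq_bigr => z _; rewrite border0l !mxE.
split=> //.
have BZ x y : (B *m Z) x y = (border r B *m X) (lift ord0 x) (lift ord0 y).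
  rewrite [RHS]mxE big_ord_recl borderl0 eq0 mulrN mulr_sumr -sumrN -big_split.
  rewrite mxE; apply: eq_bigr => z _ /=; rewrite borderll !mxE; ring.
apply/matrixP => x y; rewrite [LHS]mxE [RHS]mxE BZ; case: ifPn => //.
have [->|xi] := eqVneq x i; last by rewrite rX// (inj_eq lift_inj).
by rewrite negbK => /eqP->; exact: mulmx_diag_hadamard0.
Qed.

Lemma border_eq0 m (X : 'M[R]_m.+1) :
    X^T = X -> X ord0 ord0 = 0 -> (forall x, X ord0 (lift ord0 x) = 0) ->
    principal_delete ord0 X = 0 ->
  X = 0.
Proof.
move=> sX X00 X0l /matrixP Xll; apply/matrixP => x y; rewrite [RHS]mxE.
case: (unliftP ord0 x) => [x' ->|->]; case: (unliftP ord0 y) => [y' ->|->] //.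
  by have := Xll x' y'; rewrite !mxE.
by rewrite (trmx_entry _ _ sX).
Qed.

Lemma allows_with_SNIP_add_vertex m (H : sgraph m.+1) (G : sgraph m)
    (i : 'I_m) k l :
    (forall w, ~~ H ord0 w) ->
    (forall x y, G x y = H (lift ord0 x) (lift ord0 y)) ->
    allows_with_SNIP R (RootedGraph G i) k l ->
  allows_with_SNIP R (RootedGraph H (lift ord0 i)) k l.
Proof.
move=> H0 GH [A [/= [sA GA] nA snipA]].
exists (border 0 A); split=> /=.
- split=> [|x y]; first exact: tr_border.
  case: (unliftP ord0 x) => [x' ->|->]; case: (unliftP ord0 y) => [y' ->|->] xy.
  + rewrite borderll !mxE mulr0 addr0 -GH; apply: GA.
    by rewrite (inj_eq lift_inj) in xy.
  + by rewrite borderl0 mxE eqxx edge_sym (negPf (H0 _)).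
  + by rewrite border0l mxE eqxx (negPf (H0 _)).
  + by rewrite eqxx in xy.
- by rewrite nullity_pair_border.
apply: SNIP_intro => [|X sX BX dX rX]; first exact: tr_border.
have [X0 AZ] := border_SNIP_equations sX BX rX.
apply: border_eq0 => // [x|].
  by rewrite X0 big1 ?oppr0// => z _; rewrite mxE mul0r.
apply: (SNIP_entries snipA) => [|x y|x|x y xi].
- by apply/matrixP => x y; rewrite !mxE (trmx_entry _ _ sX).
- have := BX (lift ord0 x) (lift ord0 y).
  by rewrite borderll !mxE mulr0 addr0.
- by rewrite !mxE dX.
- have := AZ => /matrixP/(_ x y); rewrite [LHS]mxE [RHS]mxE.
  by rewrite (negPf xi).
Qed.

End Border.

(** * Undoing a contraction *)

Section Uncontract.
Variable R : realType.

(* Vertex [ord0] of [H] is the one absorbed by [u]. A matrix [B] near that of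
   [G] becomes the Schur complement of [border r B], where the entry of [r] at
   [u] is the large number 1/e; the other entries of [r] are chosen so that the
   entries of [border r B] at [u] vanish off the edges of [H], and the remaining
   nonedges of [H] then prescribe entries of [B] of size e^2. *)
Lemma allows_with_SNIP_uncontract m (H : sgraph m.+1) (G : sgraph m)
    (i u : 'I_m) k l :
    H ord0 (lift ord0 u) ->
    (forall x y, G x y = (x != y) &&
      [|| H (lift ord0 x) (lift ord0 y), (x == u) && H ord0 (lift ord0 y)
        | (y == u) && H ord0 (lift ord0 x)]) ->
    allows_with_SNIP R (RootedGraph G i) k l ->
  allows_with_SNIP R (RootedGraph H (lift ord0 i)) k l.
Proof.
move=> H0u GE [A [/= GA nA snipA]].
(* The bordered entry at (u, x) will be (1 - c x) B u x: weight 1 cancels it when x is adjacent to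
   [ord0] only, weight 2 flips its sign when x is adjacent to both. *)
pose c x : R := if (x != u) && H ord0 (lift ord0 x)
  then if H (lift ord0 u) (lift ord0 x) then 2 else 1 else 0.
have cu : c u = 0 by rewrite /c eqxx.
have c0 x : 0 <= c x by rewrite /c; do 2?[case: ifP => _].
have c2 x : c x <= 2 by rewrite /c; do 2?[case: ifP => _];
  rewrite ?lexx ?ler0n ?ler1n.
(* Away from u, r_x r_y = e^2 c x c y B u x B u y; on the nonedges of G, B must cancel this, with t
   = e^2. *)
pose W (B : 'M[R]_m) : 'M[R]_m :=
  \matrix_(x, y) - (c x * c y * (B u x * B u y)).
have Wsym B : B^T = B -> (W B)^T = W B.
  by move=> _; apply/matrixP => x y; rewrite !mxE; ring.
pose b := `|A| + 1; have b0 : 0 <= b by rewrite addr_ge0.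
have Bb (B : 'M[R]_m) x y : `|B - A| <= 1 -> `|B x y| <= b.
  move=> BA; rewrite (le_trans (norm_entry _ _ _))// -(subrK A B).
  by rewrite (le_trans (ler_normD _ _))// /b addrC lerD2l.
have cc x y : 0 <= c x * c y <= 4.
  rewrite mulr_ge0//= (_ : 4 = 2 * 2); last by ring.
  by rewrite ler_pM.
have WL B B' : `|B - A| <= 1 -> `|B' - A| <= 1 ->
    `|W B - W B'| <= 8 * b * `|B - B'|.
  move=> BA B'A; apply: norm_mx_le => [|x y]; first by rewrite !mulr_ge0.
  have -> : (W B - W B') x y = - (c x * c y *
      (B u x * (B - B') u y + B' u y * (B - B') u x)).
    by rewrite !mxE; ring.
  rewrite normrN normrM; have /andP[cxy0 cxy4] := cc x y.
  rewrite (ger0_norm cxy0) (_ : 8 * b * _ = 4 * (2 * (b * `|B - B'|)));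
    last by ring.
  rewrite ler_pM// (le_trans (ler_normD _ _))// !normrM mulr_natl mulr2n.
  by rewrite lerD// ler_pM// ?Bb// norm_entry.
have [d1 d10 open_d1] := SNIP_open GA snipA.
have [d2 d20 bound_d2] := nonzero_entries_bound A.
(* On edges of G the entries of B stay above [d2 / 2], so the term r_x r_y, of size at most d,
   cannot cancel them. *)
pose d := Num.min 1 (Num.min d1 (d2 / 2)).
have d22 : 0 < d2 / 2 by rewrite divr_gt0.
have d0 : 0 < d by rewrite !lt_min d10 d22 ltr01.
have dd1 : d <= 1 by rewrite !ge_min lexx.
have ddd1 : d <= d1 by rewrite !ge_min lexx orbT.
have dd2 : d <= d2 / 2 by rewrite !ge_min lexx !orbT.
have L0 : 0 <= 8 * b by rewrite mulr_ge0.
have [t0 t00 Bt] := SNIP_perturb GA snipA Wsym L0 WL d0.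
(* The summands bound r_x r_y and the entries Z u y respectively. *)
pose C := 4 * (b * b) + m%:R * (2 * b).
have mb0 : 0 <= m%:R * (2 * b) by rewrite !mulr_ge0.
have bb0 : 0 <= b * b by rewrite !mulr_ge0.
have C0 : 0 <= C by rewrite addr_ge0// mulr_ge0.
pose e := Num.min 1 (Num.min t0 (d / (1 + C))).
have e0 : 0 < e by rewrite !lt_min ltr01 t00 divr_gt0// ltr_wpDr.
pose t := e * e; have t_gt0 : 0 < t by rewrite mulr_gt0.
have te : t <= e by rewrite /t ler_piMl ?ge_min ?lexx// ltW.
have tt0 : 0 < t <= t0.
  by rewrite t_gt0 (le_trans te)// !ge_min lexx !orbT.
have tdC : 0 <= t <= d / (1 + C).
  by rewrite ltW//= (le_trans te)// !ge_min lexx !orbT.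
have t4 : t * (4 * (b * b)) <= d.
  by rewrite (ler_mul_small C0 tdC)// /C; lra.
have tm : t * (m%:R * (2 * b)) <= d.
  by rewrite (ler_mul_small C0 tdC)// /C; lra.
have [B [sB BA nB BE]] := Bt t tt0.
have B1 : `|B - A| <= 1 by rewrite (le_trans BA).
have Gneq x y : G x y -> x != y by rewrite GE => /andP[].
have Bd x y : G x y -> d2 / 2 < `|B x y|.
  move=> Gxy; have := bound_d2 x y; case: GA => _ ->; last exact: Gneq.
  move=> /(_ Gxy); have := norm_entry (B - A) x y; rewrite !mxE.
  have := ler_normB (B x y) (B x y - A x y); rewrite opprB addrCA subrr addr0.
  by move: BA dd2; lra.
have B0 x y : G x y -> B x y != 0.
  by move/Bd; apply: contraTneq => ->; rewrite normr0 -leNgt ltW.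
have Buy y : y != u -> ~~ G u y -> B u y = 0.
  move=> yu nG; rewrite BE; last by rewrite /nonedge eq_sym yu.
  by rewrite mxE cu !mul0r oppr0 mulr0.
pose r : 'rV[R]_m := \row_x ((x == u)%:R / e - e * (c x * B u x)).
have e_neq0 : e != 0 by rewrite gt_eqF.
pose M := border r B.
have ru : r 0 u = e^-1 by rewrite mxE eqxx cu mul0r mulr0 subr0 mul1r.
have rx x : x != u -> r 0 x = - (e * (c x * B u x)).
  by move=> xu; rewrite mxE (negPf xu) mul0r sub0r.
have H0 x : (r 0 x != 0) = H ord0 (lift ord0 x).
  have [->|xu] := eqVneq x u; first by rewrite ru H0u invr_neq0.
  rewrite rx// oppr_eq0 !mulf_eq0 (negPf e_neq0) /= negb_or.
  rewrite /c xu /=; case: ifP => [H0x|]; last by rewrite eqxx.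
  rewrite B0; last by rewrite GE eq_sym xu eqxx H0x orbT.
  by rewrite andbT; case: ifP => _; rewrite ?oner_eq0 ?pnatr_eq0.
have Hu y : y != u -> (M (lift ord0 u) (lift ord0 y) != 0) =
    H (lift ord0 u) (lift ord0 y).
  move=> yu; rewrite borderll ru rx// mulrN mulrA mulVf// mul1r.
  have -> : B u y - c y * B u y = (1 - c y) * B u y by ring.
  have := GE u y; rewrite eq_sym yu eqxx (negPf yu) /= orbF /c yu /=.
  case: ifP => [H0y|_]; last first.
    by rewrite orbF subr0 mul1r => <-; have [/B0//|/Buy->//] := boolP (G u y);
      rewrite eqxx.
  rewrite orbT => /B0 nz; case: ifP => _; last by rewrite subrr mul0r eqxx.
  by rewrite mulf_neq0// (_ : 1 - 2 = -1) ?oppr_eq0 ?oner_eq0//; ring.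
have sM : M^T = M by exact: tr_border.
have HM p q : p != q -> (M p q != 0) = H p q.
  case: (unliftP ord0 p) => [x ->|->]; case: (unliftP ord0 q) => [y ->|->] xy.
  - rewrite (inj_eq lift_inj) in xy.
    have [xu|xu] := eqVneq x u; first by rewrite xu Hu// -xu eq_sym.
    have [yu|yu] := eqVneq y u.
      by rewrite (trmx_entry _ _ sM) yu Hu// edge_sym.
    have := GE x y; rewrite xy (negPf xu) (negPf yu) /= orbF => <-.
    rewrite borderll !rx//.
    have -> : - (e * (c x * B u x)) * - (e * (c y * B u y)) =
        t * (c x * c y * (B u x * B u y)) by rewrite /t; ring.
    have [Gxy|nGxy] := boolP (G x y); last first.
      by rewrite BE /nonedge ?xy// mxE mulrN addNr eqxx.
    apply/eqP => /eqP; rewrite addr_eq0 => /eqP Bxy.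
    have := Bd x y Gxy; rewrite Bxy normrN; apply/negP; rewrite -leNgt.
    rewrite (le_trans _ dd2)// (le_trans _ t4)// normrM gtr0_norm//.
    rewrite ler_wpM2l ?(ltW t_gt0)// normrM; have /andP[cxy0 cxy4] := cc x y.
    by rewrite ger0_norm// ler_pM// normrM ler_pM// Bb.
  - by rewrite borderl0 H0 edge_sym.
  - by rewrite border0l H0.
  - by rewrite eqxx in xy.
exists M; split=> //=; first by rewrite nullity_pair_border nB.
apply: SNIP_intro => // X sX MX dX rX.
have [X0 BZ] := border_SNIP_equations sX MX rX.
set Z := principal_delete ord0 X in X0 BZ.
have sZ : Z^T = Z by apply/matrixP => x y; rewrite !mxE (trmx_entry _ _ sX).
have MX0 p q : p != q -> H p q -> X p q = 0.
  by move=> pq Hpq; have /eqP := MX p q;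
    rewrite mulf_eq0 (negPf (_ : M p q != 0)) ?HM// => /eqP.
(* Here X vanishes at (0, y), so the row 0 equation reads Z u y = e^2 times the sum of c z B u z Z z
   y: small but perhaps nonzero. *)
have Zu y : y != u -> H ord0 (lift ord0 y) -> `|Z u y| <= d * `|Z|.
  move=> yu H0y; have /eqP := X0 y; rewrite MX0// eq_sym oppr_eq0.
  have -> : \sum_z r 0 z * Z z y =
      Z u y / e - e * \sum_z (c z * B u z) * Z z y.
    rewrite mulr_sumr (bigD1 u)//= [X in _ - X](bigD1 u)//= ru cu !mul0r mulr0.
    rewrite add0r mulrC -sumrN; congr (_ + _); apply: eq_bigr => z zu.
    by rewrite rx//; ring.
  rewrite subr_eq0 => /eqP/(congr1 ( *%R e)).
  rewrite mulrC mulfVK// mulrA -/t => ->.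
  rewrite normrM gtr0_norm// (le_trans _ (ler_wpM2r (normr_ge0 Z) tm))//.
  rewrite -[leRHS]mulrA ler_wpM2l ?(ltW t_gt0)//
    (le_trans (ler_norm_sum _ _ _))//.
  rewrite -[leRHS]mulrA [leRHS]mulr_natl -[X in _ *+ X]card_ord -sumr_const
    ler_sum// => z _.
  by rewrite normrM ler_pM ?norm_entry// normrM ler_pM ?Bb// ger0_norm.
have Z0 : Z = 0.
  apply: (open_d1 B) => //; first by rewrite (le_trans BA).
  apply: (@le_trans _ _ (d * `|Z|)); last by rewrite ler_wpM2r.
  have dZ : 0 <= d * `|Z| by rewrite mulr_ge0// ltW.
  apply: norm_mx_le => // x y; rewrite mxE [X in _ + X]mxE.
  rewrite [nonedge_part _ _ _ _]mxE (trmx_entry y x sZ); case: ifPn => [_|].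
    by rewrite (_ : _ - _ = 0) ?normr0//; field.
  rewrite subr0 negb_and !negbK => /orP[/eqP->|];
    first by rewrite !mxE dX normr0.
  (* An edge of G inherited from H forces a zero of Z; one coming from the absorbed vertex is
     handled by [Zu]. *)
  rewrite GE => /andP[xy /or3P[Hxy|/andP[/eqP xu H0y]|/andP[/eqP yu H0x]]].
  - by rewrite !mxE MX0 ?normr0// (inj_eq lift_inj).
  - by rewrite xu Zu// -xu eq_sym.
  - by rewrite (trmx_entry _ _ sZ) yu Zu// -yu.
apply: border_eq0 => // x.
by rewrite X0 Z0 big1 ?oppr0// => z _; rewrite [X in _ * X]mxE mulr0.
Qed.

End Uncontract.

(** * Reduction of minor operations to index 0 *)

Definition relabel_rel m n (H : sgraph n) (f : 'I_m -> 'I_n) : rel 'I_m :=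
  fun x y => H (f x) (f y).

Lemma relabel_sym m n (H : sgraph n) (f : 'I_m -> 'I_n) :
  symmetric (relabel_rel H f).
Proof. by move=> x y; rewrite /relabel_rel edge_sym. Qed.

Lemma relabel_irr m n (H : sgraph n) (f : 'I_m -> 'I_n) :
  irreflexive (relabel_rel H f).
Proof. by move=> x; rewrite /relabel_rel edge_irr. Qed.

Definition relabel m n (H : sgraph n) (f : 'I_m -> 'I_n) : sgraph m :=
  SGraph (relabel_sym H f) (relabel_irr H f).

Lemma allows_with_SNIP_relabel (R : realType) m n (H : sgraph n)
    (f : 'I_m -> 'I_n) (i : 'I_m) k l :
    bijective f ->
    allows_with_SNIP R (RootedGraph (relabel H f) i) k l ->
  allows_with_SNIP R (RootedGraph H (f i)) k l.
Proof. by move=> bf; apply: allows_with_SNIP_iso; exists f. Qed.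

(** Keeping the order of the other vertices makes this agree with the numbering by [lift v] in the
    minor operations. *)
Definition move_to_front m (v : 'I_m.+1) (p : 'I_m.+1) : 'I_m.+1 :=
  if unlift ord0 p is Some x then lift v x else v.

Lemma move_to_front0 m (v : 'I_m.+1) : move_to_front v ord0 = v.
Proof. by rewrite /move_to_front unlift_none. Qed.

Lemma move_to_frontl m (v : 'I_m.+1) x : move_to_front v (lift ord0 x) = lift v
  x.
Proof. by rewrite /move_to_front liftK. Qed.

Lemma move_to_front_bij m (v : 'I_m.+1) : bijective (move_to_front v).
Proof.
exists (fun p => if unlift v p is Some x then lift ord0 x else ord0) => p.
  case: (unliftP ord0 p) => [x ->|->]; first by rewrite move_to_frontl liftK.
  by rewrite move_to_front0 unlift_none.
case: (unliftP v p) => [x ->|->]; first by rewrite move_to_frontl.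
by rewrite move_to_front0.
Qed.

(* The permutation s exchanges u and v when v is the root, so that the vertex
   removed by the contraction is never the root. *)
Lemma contractE m (H : sgraph m.+1) (u v : 'I_m.+1) (u' : 'I_m) (s : 'S_m.+1) :
    lift v u' = u -> s = 1%g \/ s = tperm u v ->
  forall x y, contract H u v x y = (x != y) &&
    [|| H (s (lift v x)) (s (lift v y)),
        (x == u') && H (s v) (s (lift v y))
      | (y == u') && H (s v) (s (lift v x))].
Proof.
move=> u'u sP.
have uv : u != v by rewrite -u'u eq_sym neq_lift.
have lu x : (lift v x == u) = (x == u') by rewrite -u'u (inj_eq lift_inj).
(* The class named [u'] is {u, v}, that is {s (lift v u'), s v}; every other class is a single
   vertex fixed by s. *)
have idE x a : (identify u v a == lift v x) =
    (a == s (lift v x)) || (x == u') && (a == s v).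
  rewrite /identify; have [->|xu] := eqVneq x u'.
    rewrite u'u; case: sP => ->; rewrite ?perm1 ?tpermL ?tpermR /=.
      by case: (eqVneq a v) => //=; rewrite ?eqxx ?orbT ?orbF.
    by case: (eqVneq a v) => //=; rewrite ?eqxx.
  rewrite /= orbF.
  have -> : s (lift v x) = lift v x.
    case: sP => ->; rewrite ?perm1// tpermD ?neq_lift//.
    by rewrite eq_sym lu.
  have [->|//] := eqVneq a v.
  by rewrite eq_sym lu (negPf xu) (negPf (neq_lift v x)).
move=> x y /=; rewrite /contract_rel; have [//|xy] := eqVneq x y;
  rewrite !andTb.
apply/existsP/or3P => [[a /existsP[b]]|].
  rewrite !idE => /and3P[].
  move=> /orP[/eqP->|/andP[xu /eqP->]] /orP[/eqP->|/andP[yu /eqP->]] Hab.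
  - by constructor 1.
  - by constructor 3; rewrite yu edge_sym.
  - by constructor 2; rewrite xu.
  - by rewrite (eqP xu) (eqP yu) eqxx in xy.
case=> [Hxy|/andP[xu Hvy]|/andP[yu Hvx]].
- by exists (s (lift v x)); apply/existsP; exists (s (lift v y));
    rewrite !idE !eqxx.
- by exists (s v); apply/existsP; exists (s (lift v y));
    rewrite !idE !eqxx xu orbT.
- by exists (s (lift v x)); apply/existsP; exists (s v);
    rewrite !idE !eqxx yu orbT edge_sym.
Qed.

Lemma allows_with_SNIP_minor_step (R : realType) (G H : rooted_graph) k l :
  minor_step G H -> allows_with_SNIP R G k l -> allows_with_SNIP R H k l.
Proof.
case=> {G H} [n H i u v Huv|[|n] H i v j|[|n] H i u v j]; try by case: v.
- exact: allows_with_SNIP_add_edge.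
- move=> vi H0 ji GA.
  rewrite -ji -move_to_frontl.
  apply: allows_with_SNIP_relabel (move_to_front_bij v) _.
  apply: allows_with_SNIP_add_vertex GA => [w|x y] /=.
    by rewrite /relabel_rel move_to_front0.
  by rewrite /relabel_rel !move_to_frontl.
- move=> Huv ji GA.
  have uv : v != u by apply: contraTneq Huv => ->; rewrite edge_irr.
  have /unlift_some[u' u'E _] := uv.
  pose s : 'S_n.+1 := if i == v then tperm u v else 1%g.
  have sP : s = 1%g \/ s = tperm u v by rewrite /s; case: ifP; [right|left].
  (* [lift v j] names the class of the root; if the root is v this name is u, which the swap sends
     back to v. *)
  have -> : i = (s \o move_to_front v) (lift ord0 j).
    rewrite /= move_to_frontl ji /identify /s; case: eqP => [->|_].
      by rewrite tpermL.
    by rewrite perm1.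
  apply: allows_with_SNIP_relabel.
    exact: bij_comp (injF_bij (@perm_inj _ s)) (move_to_front_bij v).
  apply: (@allows_with_SNIP_uncontract _ _ _ _ _ u') GA.
    rewrite /= /relabel_rel /= move_to_front0 move_to_frontl -u'E.
    by case: sP => ->; rewrite ?perm1 ?tpermL ?tpermR // edge_sym.
  move=> x y; rewrite (contractE H (esym u'E) sP) /= /relabel_rel /=.
  by rewrite !move_to_frontl move_to_front0.
Qed.

Theorem theorem1p3 (R : realType) (G H : rooted_graph) (k l : nat) :
  rooted_minor G H ->
  allows_with_SNIP R G k l ->
  allows_with_SNIP R H k l.
Proof.
elim=> {G H} [G H|G K H _ IH] GH; first exact: allows_with_SNIP_iso.
by move=> /IH; exact: allows_with_SNIP_minor_step.
Qed.
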